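(* Let $A \in \mathcal{H}_{\alpha}(\mathbb{R}^{\mathbb{N}})$ and let $\lambda_A$ be the main eigenvalue of the Ruelle operator $\mathcal{L}_A$. Then $$\log(\lambda_A) = \sup_{\mu \in \mathcal{M}_{\sigma}(\mathbb{R}^{\mathbb{N}})}\left\{ h(\mu) + \int_{\mathbb{R}^{\mathbb{N}}} A \, d\mu \right\}.$$ Moreover, the supremum is attained at the Gibbs state $\mu_A$ associated to $A$.
   Context: Points of $\mathbb{R}^{\mathbb{N}}$ are $x=(x_1,x_2,\ldots)$; $\sigma$ is the left shift; $ax=(a,x_1,x_2,\ldots)$. The metric on $\mathbb{R}^{\mathbb{N}}$ is $d(x,y)=\sum_{n\ge 1}\frac{1}{\pi 2^n}|\arctan(x_n)-\arctan(y_n)|$. $\mathcal{H}_\alpha(\mathbb{R}^{\mathbb{N}})$ is the set of real-valued $\alpha$-Hölder functions for $d$ (exponent $\alpha\in(0,1]$ fixed). $\mathcal{M}_\sigma(\mathbb{R}^{\mathbb{N}})$ is the set of $\sigma$-invariant Borel probability measures on $\mathbb{R}^{\mathbb{N}}$. Fix a strictly positive continuous $f:\mathbb{R}\to\mathbb{R}$ with $\int_{\mathbb{R}} f(a)\,da=1$. The Ruelle operator is $\mathcal{L}_A(\varphi)(x)=\int_{\mathbb{R}} e^{A(ax)}\varphi(ax)f(a)\,da$; in particular $\mathcal{L}_0(u)(x)=\int_{\mathbb{R}} u(ax)f(a)\,da$. Its dual is defined by $\int\varphi\, d(\mathcal{L}_A^*\mu)=\int\mathcal{L}_A(\varphi)\,d\mu$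 for bounded continuous $\varphi$. There are $\lambda_A>0$ (simple; the main eigenvalue) and a strictly positive $\alpha$-Hölder function $\psi_A$ with $\mathcal{L}_A\psi_A=\lambda_A\psi_A$. With $\bar A=A+\log\psi_A-\log(\psi_A\circ\sigma)-\log\lambda_A$, the Gibbs state $\mu_A$ is the unique element of $\mathcal{M}_\sigma(\mathbb{R}^{\mathbb{N}})$ with $\mathcal{L}_{\bar A}^*\mu_A=\mu_A$. The entropy of $\mu\in\mathcal{M}_\sigma(\mathbb{R}^{\mathbb{N}})$ is $$h(\mu)=\inf_{u\in\mathcal{C}_b^+(\mathbb{R}^{\mathbb{N}})}\left\{\int_{\mathbb{R}^{\mathbb{N}}}\log\left(\frac{\mathcal{L}_0(u)}{u}\right)d\mu\right\},$$ where $\mathcal{C}_b^+(\mathbb{R}^{\mathbb{N}})$ is the set of strictly positive bounded continuous real functions on $\mathbb{R}^{\mathbb{N}}$.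
   Formalization: In the definition of the entropy h(μ), the infimum is taken only over those u in C_b^+ for which the integral of log(L_0(u)/u) exists in [-∞,+∞], since for some u both its positive and negative parts have infinite integral and the expression is undefined. *)

(* Defs.v *)
From HB Require Import structures.
From mathcomp Require Import all_boot all_order all_algebra.
From mathcomp Require Import all_classical all_reals all_analysis.

Set Implicit Arguments.
Unset Strict Implicit.
Unset Printing Implicit Defensive.
Import Order.TTheory GRing.Theory Num.Theory.
Import numFieldTopology.Exports numFieldNormedType.Exports.

Local Open Scope classical_set_scope.
Local Open Scope ring_scope.

(* R^N, the point (x_1, x_2, ...) being n |-> x_{n+1}. This is an alias of
   nat -> R because the bare function type already carries the topology of
   uniform convergence; here the topology is the one of the distance rseqd. *)
Definition rseq (R : realType) : Type := nat -> R.

HB.instance Definition _ (R : realType) := Choice.copy (rseq R) (nat -> R).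
HB.instance Definition _ (R : realType) := isPointed.Build (rseq R) (fun=> 0).

Definition rseqd_term (R : realType) (x y : rseq R) (n : nat) : R :=
  (pi * 2 ^+ n.+1)^-1 * `|atan (x n) - atan (y n)|.

Definition rseqd (R : realType) (x y : rseq R) : R :=
  limn (series (rseqd_term x y)).

Section rseqd_metric.
Variable R : realType.
Implicit Types x y z : rseq R.

Lemma rseqd_term_ge0 x y n : 0 <= rseqd_term x y n.
Proof. by rewrite mulr_ge0// invr_ge0 mulr_ge0 ?pi_ge0// exprn_ge0. Qed.

Lemma rseqd_term_le x y n : rseqd_term x y n <= geometric (2^-1) (2^-1) n.
Proof.
rewrite /rseqd_term /= -exprS exprVn invfM mulrAC ler_piMl ?invr_ge0 ?exprn_ge0//.
rewrite mulrC ler_pdivrMr ?pi_gt0// mul1r ler_norml.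
have xl := atan_gtNpi2 (x n); have xu := atan_ltpi2 (x n).
have yl := atan_gtNpi2 (y n); have yu := atan_ltpi2 (y n).
have pE : pi = pi / 2 + pi / 2 :> R by rewrite -splitr.
rewrite {1 2}pE opprD; apply/andP; split.
  by apply: lerD; [exact: ltW|rewrite lerN2; exact: ltW].
by apply: lerD; [exact: ltW|rewrite lerNl; exact: ltW].
Qed.

Lemma is_cvg_rseqd x y : cvgn (series (rseqd_term x y)).
Proof.
apply: (@series_le_cvg R _ (geometric (2^-1) (2^-1))) => [n|n|n|].
- exact: rseqd_term_ge0.
- by rewrite /= mulr_ge0 ?exprn_ge0 ?invr_ge0.
- exact: rseqd_term_le.
- by apply: is_cvg_geometric_series; rewrite ger0_norm ?invr_ge0// invf_lt1// ltr1n.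
Qed.

Lemma rseqdxx x : rseqd x x = 0.
Proof.
rewrite /rseqd (_ : series _ = fun=> 0) ?lim_cst//; apply/funext => n.
by rewrite /series /= big1// => i _; rewrite /rseqd_term subrr normr0 mulr0.
Qed.

Lemma rseqd_sym x y : rseqd x y = rseqd y x.
Proof.
rewrite /rseqd (_ : rseqd_term x y = rseqd_term y x)//; apply/funext => n.
by rewrite /rseqd_term distrC.
Qed.

Lemma rseqd_triangle y x z : rseqd x z <= rseqd x y + rseqd y z.
Proof.
rewrite /rseqd -lim_seriesD; [|exact: is_cvg_rseqd..].
apply: lim_series_le => [||n]; [exact: is_cvg_rseqd| |].
  rewrite seriesD; apply: is_cvgD; exact: is_cvg_rseqd.
rewrite /rseqd_term /= -mulrDr ler_wpM2l ?ler_distD//.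
by rewrite invr_ge0 mulr_ge0 ?pi_ge0// exprn_ge0.
Qed.

Lemma rseqd_term_le_rseqd x y n : rseqd_term x y n <= rseqd x y.
Proof.
apply: (@le_trans _ _ (series (rseqd_term x y) n.+1)).
  rewrite /series /= big_nat_recr//= lerDr sumr_ge0// => i _.
  exact: rseqd_term_ge0.
apply: nondecreasing_cvgn_le; last exact: is_cvg_rseqd.
by apply: nondecreasing_series => i _ _; exact: rseqd_term_ge0.
Qed.

Lemma rseqd_positivity x y : rseqd x y = 0 -> x = y.
Proof.
move=> xy; apply/funext => n; apply: (can_inj (@atanK R)).
apply/eqP; rewrite -subr_eq0 -normr_eq0.
have : rseqd_term x y n == 0.
  by rewrite eq_le rseqd_term_ge0 andbT -xy rseqd_term_le_rseqd.
rewrite mulf_eq0 invr_eq0 mulf_eq0 expf_eq0 pnatr_eq0 andbF orbF.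
by rewrite gt_eqF ?pi_gt0.
Qed.

HB.instance Definition _ := isMetric.Build R (rseq R)
  rseqdxx rseqd_positivity rseqd_sym rseqd_triangle.

End rseqd_metric.

(* The Borel sigma-algebra of (rseq R, rseqd). *)
HB.instance Definition _ (R : realType) :=
  Measurable.copy (rseq R) (g_sigma_algebraType (@open (rseq R))).

Definition rseq_shift (R : realType) (x : rseq R) : rseq R := fun n => x n.+1.

Definition rseq_cons (R : realType) (a : R) (x : rseq R) : rseq R :=
  fun n => if n is m.+1 then x m else a.

Definition holder (R : realType) (alpha : R) : set (rseq R -> R) :=
  [set A | exists C : R, forall x y, `|A x - A y| <= C * mdist x y `^ alpha].

(* L_A, as the operator phi |-> (x |-> \int e^{A(ax)} phi(ax) f(a) da). *)
Definition ruelle (R : realType) (f : R -> R) (A phi : rseq R -> R)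
    (x : rseq R) : R :=
  \int[lebesgue_measure]_a
    (expR (A (rseq_cons a x)) * phi (rseq_cons a x) * f a).

(* nu = L_A^* mu *)
Definition ruelle_dual (R : realType) (f : R -> R) (A : rseq R -> R)
    (mu nu : {measure set (rseq R) -> \bar R}) : Prop :=
  forall phi : rseq R -> R, continuous phi -> bounded_fun phi ->
  (\int[nu]_x (phi x)%:E = \int[mu]_x (ruelle f A phi x)%:E)%E.

Definition shift_invariant (R : realType) : set (probability (rseq R) R) :=
  [set mu | forall B, measurable B -> mu (@rseq_shift R @^-1` B) = mu B].

Definition main_eigenpair (R : realType) (alpha : R) (f : R -> R)
    (A : rseq R -> R) (lambda : R) (psi : rseq R -> R) : Prop :=
  [/\ 0 < lambda, holder alpha psi, (forall x, 0 < psi x) &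
      forall x, ruelle f A psi x = lambda * psi x].

Definition normalized (R : realType) (A : rseq R -> R) (lambda : R)
    (psi : rseq R -> R) (x : rseq R) : R :=
  A x + ln (psi x) - ln (psi (rseq_shift x)) - ln lambda.

Definition gibbs_state (R : realType) (f : R -> R) (A : rseq R -> R)
    (lambda : R) (psi : rseq R -> R) (mu : probability (rseq R) R) : Prop :=
  shift_invariant mu /\ ruelle_dual f (normalized A lambda psi) mu mu.

Definition pos_bounded_continuous (R : realType) : set (rseq R -> R) :=
  [set u : rseq R -> R | [/\ continuous u, bounded_fun u & forall x, 0 < u x]].

Definition has_integral (R : realType) (mu : probability (rseq R) R)
    (w : rseq R -> R) : Prop :=
  (\int[mu]_x ((EFin \o w)^\+ x) < +oo)%E \/
  (\int[mu]_x ((EFin \o w)^\- x) < +oo)%E.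

Definition log_ratio (R : realType) (f : R -> R) (u : rseq R -> R)
    (x : rseq R) : R :=
  ln (ruelle f (fun=> 0) u x / u x).

(* The function log (L_0 u / u) can be unbounded in both directions. The
   infimum ranges over the u for which its integral exists in [-oo, +oo];
   the library integral would otherwise return -oo for "+oo - oo". *)
Definition entropy (R : realType) (f : R -> R) (mu : probability (rseq R) R)
    : \bar R :=
  ereal_inf [set (\int[mu]_x (log_ratio f u x)%:E)%E |
    u in [set u | pos_bounded_continuous u /\ has_integral mu (log_ratio f u)]].

(* Main.v *)
(* Upper bound: u = e^A psi is an admissible test function for every mu, and
   L_0 u / u = lambda e^{-A}, so h(mu) <= log lambda - \int A dmu.

   Lower bound for the Gibbs state: write any test function as u = e^A psi v.
   Then log (L_0 u / u) = log lambda - A + log (P v / v), where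
   P = L_{\bar A} is a Markov operator preserving mu_A. When log v is bounded,
   Jensen's inequality gives \int log (P v) >= \int P (log v) = \int log v.
   In general v is replaced by v + epsilon (bounded above, because psi is
   bounded below) and epsilon is sent to 0 in the positive and negative parts
   separately. *)

Require Import Defs.
From mathcomp Require Import all_boot all_order all_algebra.
From mathcomp Require Import all_classical all_reals all_analysis.
From mathcomp Require Import ring lra measurable_realfun.
Import Order.TTheory GRing.Theory Num.Theory.
Import numFieldTopology.Exports numFieldNormedType.Exports.
Local Open Scope classical_set_scope.
Local Open Scope ring_scope.

Set Implicit Arguments.
Unset Strict Implicit.

Local Notation is_bounded u := (exists M, forall y, `|u y| <= M).

(** * The distance on the sequence space, continuity and Hölder functions *)

Lemma mdistE (R : realType) (x y : rseq R) : mdist x y = rseqd x y.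
Proof. by []. Qed.

Lemma rseq_continuousP (R : realType) (F : rseq R -> R) :
  continuous F <-> forall x e, 0 < e ->
    exists2 d, 0 < d & forall y, rseqd x y < d -> `|F x - F y| < e.
Proof.
split=> [cF x e e0|cF x].
  have /cvgrPdist_lt/(_ e e0)/nbhs_ballP[d /= d0 xd] := cF x.
  by exists d => // y xy; apply: xd; rewrite ballEmdist/= mdistE.
apply/(@cvgrPdist_lt _ _ _ (nbhs x)) => e e0; have [d d0 xd] := cF x e e0.
apply/nbhs_ballP; exists d => //= y; rewrite ballEmdist/= mdistE; exact: xd.
Qed.

(** Split off the first term of the series and reindex the rest, which gains a factor 1/2. Estimates
    on prepended points and inductions on coordinates rest on this recursion. *)
Lemma rseqd_rec (R : realType) (x y : rseq R) :
  rseqd x y = (pi * 2)^-1 * `|atan (x 0) - atan (y 0)|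
              + 2^-1 * rseqd (rseq_shift x) (rseq_shift y).
Proof.
apply: cvg_lim => //; rewrite -cvg_shiftS /=.
rewrite (_ : (fun n => _) = fun n => (pi * 2)^-1 * `|atan (x 0) - atan (y 0)|
    + 2^-1 * series (rseqd_term (rseq_shift x) (rseq_shift y)) n).
  by apply: cvgD; [exact: cvg_cst|apply: cvgMr; exact: is_cvg_rseqd].
apply/funext => n; rewrite /series/= big_nat_recl//= {1}/rseqd_term expr1.
congr (_ + _); rewrite big_distrr/=; apply: eq_bigr => i _.
by rewrite /rseqd_term /rseq_shift [in LHS]exprS (mulrCA pi) invfM -mulrA.
Qed.

Lemma rseqd_ge0 (R : realType) (x y : rseq R) : 0 <= rseqd x y.
Proof. by rewrite -mdistE mdist_ge0. Qed.

Lemma rseqd_le1 (R : realType) (x y : rseq R) : rseqd x y <= 1.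
Proof.
have hl : `|2^-1| < 1 :> R by rewrite ger0_norm ?invr_ge0// invf_lt1// ltr1n.
have -> : 1 = limn (series (geometric (2^-1) (2^-1 : R))).
  have -> := cvg_lim _ (@cvg_geometric_series R 2^-1 _ hl) => //.
  by rewrite [X in _ / X](_ : _ = 2^-1) ?divff//; lra.
apply: lim_series_le; [exact: is_cvg_rseqd|exact: is_cvg_geometric_series|].
exact: rseqd_term_le.
Qed.

Lemma rseqd_cons (R : realType) (a b : R) (x y : rseq R) :
  rseqd (rseq_cons a x) (rseq_cons b y) =
  (pi * 2)^-1 * `|atan a - atan b| + 2^-1 * rseqd x y.
Proof. by rewrite rseqd_rec. Qed.

Lemma continuous_consr (R : realType) (F : rseq R -> R) a :
  continuous F -> continuous (fun x => F (rseq_cons a x)).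
Proof.
move=> /rseq_continuousP cF; apply/rseq_continuousP => x e e0.
have [d d0 h] := cF (rseq_cons a x) e e0; exists d => // y xy; apply: h.
rewrite rseqd_cons subrr normr0 mulr0 add0r (le_lt_trans _ xy)//.
by rewrite ler_piMl ?rseqd_ge0// invf_le1// ler1n.
Qed.

Lemma continuous_consl (R : realType) (F : rseq R -> R) (x : rseq R) :
  continuous F -> continuous (fun a => F (rseq_cons a x)).
Proof.
move=> /rseq_continuousP cF a; apply/cvgrPdist_lt => e e0.
have [d d0 h] := cF (rseq_cons a x) e e0.
have /cvgrPdist_lt/(_ d d0) := @continuous_atan R a.
apply: filterS => b ab; apply: h.
rewrite rseqd_cons rseqdxx mulr0 addr0 (le_lt_trans _ ab)//.
by rewrite ler_piMl// invf_le1 ?mulr_gt0 ?pi_gt0//; have := @pi_ge2 R; lra.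
Qed.

Lemma continuous_measurable_rseq (R : realType) (F : rseq R -> R) :
  continuous F -> measurable_fun setT F.
Proof.
move=> /continuousP cF; apply: (measurability _ (RGenOpens.measurableE R)).
move=> _ [_ [a [b ->]] <-]; rewrite setTI; apply: sub_sigma_algebra.
exact/cF/interval_open.
Qed.

Lemma holder_continuous (R : realType) (alpha : R) (A : rseq R -> R) :
  0 < alpha -> holder alpha A -> continuous A.
Proof.
move=> a0 [C AC]; apply/rseq_continuousP => x e e0.
(* The constant in [holder] carries no sign; [C'] is a strictly positive bound for it, safe to
   divide by. *)
pose C' := `|C| + 1; have C'0 : 0 < C' by rewrite ltr_wpDl.
exists ((e / C') `^ alpha^-1) => [|y xy]; first by rewrite powR_gt0// divr_gt0.
apply: (le_lt_trans (AC x y)).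
apply: (@le_lt_trans _ _ (C' * rseqd x y `^ alpha)).
  by rewrite ler_wpM2r ?powR_ge0// /C'; have := ler_norm C; lra.
rewrite mulrC -ltr_pdivlMr//.
rewrite -[ltRHS]powRr1 ?divr_ge0 ?ltW// -(mulVf (lt0r_neq0 a0)) powRrM.
by rewrite gt0_ltr_powR// ?nnegrE ?powR_ge0 ?rseqd_ge0.
Qed.

(** Distances are at most 1, so all values lie within |C| of the value at the zero sequence. *)
Lemma holder_bounded (R : realType) (alpha : R) (A : rseq R -> R) :
  0 < alpha -> holder alpha A -> is_bounded A.
Proof.
move=> a0 [C AC]; pose o : rseq R := fun=> 0; exists (`|C| + `|A o|) => x.
rewrite -lerBlDr (le_trans (lerB_dist _ _))// (le_trans (AC x o))//.
apply: (@le_trans _ _ (`|C| * rseqd x o `^ alpha)).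
  by rewrite ler_wpM2r ?powR_ge0// ler_norm.
have p1 : 1 `^ alpha = 1 :> R by rewrite powR1.
rewrite ler_piMr// -[leRHS]p1 ge0_ler_powR ?nnegrE ?rseqd_ge0 ?rseqd_le1//.
exact: ltW.
Qed.

Lemma bounded_funE (T : Type) (R : realType) (u : T -> R) :
  bounded_fun u <-> is_bounded u.
Proof.
split=> [[M [_ uM]]|[M uM]].
  by exists (M + 1) => x; apply: uM; rewrite ?ltrDl.
exists M; split=> [|N MN x _]; first exact: num_real.
exact: (le_trans (uM x) (ltW MN)).
Qed.

(** Dominated convergence concerns sequences, so this is the form of continuity used for averages.
    For the converse, a failure at x yields points within 1/(n+1) of x whose values stay at least e
    away from F x. *)
Lemma rseq_continuous_seqP (R : realType) (F : rseq R -> R) :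
  continuous F <-> forall (x : rseq R) (s : nat -> rseq R),
    rseqd x (s n) @[n --> \oo] --> 0 -> F (s n) @[n --> \oo] --> F x.
Proof.
split=> [/rseq_continuousP cF x s /cvgrPdist_lt xs|sF].
  apply/cvgrPdist_lt => e e0; have [d d0 h] := cF x e e0.
  have := xs d d0; apply: filterS => n; rewrite sub0r normrN => xsn; apply: h.
  by rewrite (le_lt_trans _ xsn)// ler_norm.
apply/rseq_continuousP => x e e0; apply: contrapT => /forall2NP h.
have /choice[s sP] (n : nat) :
    exists y, rseqd x y < n.+1%:R^-1 /\ e <= `|F x - F y|.
  have [|/existsNP[y /not_implyP[xy /negP]]] := h n.+1%:R^-1.
    by rewrite invr_gt0// ltr0n.
  by rewrite -leNgt => Fxy; exists y.
have : F (s n) @[n --> \oo] --> F x.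
  apply: sF; apply: (@squeeze_cvgr _ _ _ _ (cst 0) (@harmonic R)).
  - by apply: nearW => n; rewrite rseqd_ge0/= ltW// (sP n).1.
  - exact: cvg_cst.
  - exact: cvg_harmonic.
move=> /cvgrPdist_lt/(_ e e0)[N _ /(_ N (leqnn N))]/=.
by rewrite ltNge (sP N).2.
Qed.

(** * The averaging operator L_0, written without its factor e^0 *)

Definition avg (R : realType) (f : R -> R) (u : rseq R -> R) (x : rseq R) : R :=
  \int[lebesgue_measure]_a (u (rseq_cons a x) * f a).

Section positive_integral.
Context d (T : measurableType d) (R : realType).

(** A zero integral would force g to vanish almost everywhere on D; as g never vanishes, D would be
    a null set. *)
Lemma integral_pos_gt0 (mu : {measure set T -> \bar R}) (D : set T)
    (g : T -> R) :
  measurable D -> measurable_fun D g -> (forall x, 0 < g x) -> (0 < mu D)%E ->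
  (0 < \int[mu]_(x in D) (g x)%:E)%E.
Proof.
move=> mD mg g0 muD; rewrite lt0e integral_ge0 ?andbT; last first.
  by move=> x _; rewrite lee_fin ltW.
apply/eqP => I0; suff : mu D = 0%E by move=> muD0; rewrite muD0 ltxx in muD.
have /measurable_EFinP mEg := mg.
have /(ae_eq_integral_abs mu mD mEg)[N [mN N0 DN]] :
    (\int[mu]_(x in D) `|(EFin \o g) x| = 0)%E.
  rewrite -I0; apply: eq_integral => x _ /=.
  by rewrite ger0_norm// ltW.
apply: (@subset_measure0 _ _ _ mu D N) => // x Dx; apply: DN => /= /(_ Dx)[].
by move=> gx; have := g0 x; rewrite gx ltxx.
Qed.

End positive_integral.

Section average.
Context (R : realType) (f : R -> R).
Hypotheses (f_cont : continuous f) (f_gt0 : forall a, 0 < f a)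
  (f_int1 : (\int[lebesgue_measure]_a (f a)%:E = 1)%E).
Implicit Types (u v : rseq R -> R) (x : rseq R).

Lemma density_integrable : lebesgue_measure.-integrable setT (EFin \o f).
Proof.
apply/integrableP; split.
  by apply/measurable_EFinP; exact: continuous_measurable_fun.
rewrite (_ : (fun _ => _) = (fun a => (f a)%:E)) ?f_int1 ?ltry//.
by apply/funext => a /=; rewrite gtr0_norm.
Qed.

Lemma avg_measurable u x : continuous u ->
  measurable_fun setT (fun a => u (rseq_cons a x) * f a).
Proof.
move=> cu; apply: measurable_funM; apply: continuous_measurable_fun => //.
exact: continuous_consl.
Qed.

Lemma avg_integrable u x : continuous u -> is_bounded u ->
  lebesgue_measure.-integrable setT (EFin \o (fun a => u (rseq_cons a x) * f a)).
Proof.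
move=> cu [M uM]; have := integrableZl measurableT M density_integrable.
apply: le_integrable => //; first by apply/measurable_EFinP; exact: avg_measurable.
move=> a _; rewrite /= lee_fin !normrM ler_wpM2r//.
by rewrite (le_trans (uM _))// ler_norm.
Qed.

Lemma avg_cst c x : avg f (fun=> c) x = c.
Proof.
rewrite /avg RintegralZl//; last exact: density_integrable.
by rewrite /Rintegral f_int1 mulr1.
Qed.

Lemma avg_le u v x : continuous u -> continuous v ->
  is_bounded u -> is_bounded v ->
  (forall a, u (rseq_cons a x) <= v (rseq_cons a x)) -> avg f u x <= avg f v x.
Proof.
move=> cu cv bu bv uv; apply: le_Rintegral => //; [exact: avg_integrable..|].
by move=> a _; rewrite ler_wpM2r// ltW.
Qed.

Lemma avgD u v x : continuous u -> continuous v ->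
  is_bounded u -> is_bounded v ->
  avg f (fun y => u y + v y) x = avg f u x + avg f v x.
Proof.
move=> cu cv bu bv; rewrite /avg -RintegralD//; [|exact: avg_integrable..].
by apply: eq_Rintegral => a _; rewrite mulrDl.
Qed.

Lemma avgZ c u x : continuous u -> is_bounded u ->
  avg f (fun y => c * u y) x = c * avg f u x.
Proof.
move=> cu bu; rewrite /avg -RintegralZl//; last exact: avg_integrable.
by apply: eq_Rintegral => a _; rewrite mulrA.
Qed.

Lemma avg_bounded u : continuous u -> is_bounded u ->
  exists M, forall y, `|avg f u y| <= M.
Proof.
move=> cu bu; have [M uM] := bu; exists M => x; rewrite ler_norml.
have bM c : exists N, forall y : rseq R, `|c| <= N :> R by exists `|c|.
apply/andP; split.
  rewrite -[leLHS](avg_cst (- M) x); apply: avg_le => // [|a].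
    exact: cst_continuous.
  by have := uM (rseq_cons a x); rewrite ler_norml => /andP[].
rewrite -[leRHS](avg_cst M x); apply: avg_le => // [|a].
    exact: cst_continuous.
by have := uM (rseq_cons a x); rewrite ler_norml => /andP[].
Qed.

Lemma avg_gt0 u x : continuous u -> is_bounded u ->
  (forall y, 0 < u y) -> 0 < avg f u x.
Proof.
move=> cu bu u0; rewrite /avg /Rintegral; apply: fine_gt0; apply/andP; split.
  apply: integral_pos_gt0 => //; first exact: avg_measurable.
    by move=> a; rewrite mulr_gt0.
  by have := @lebesgue_measure_itv R `]-oo, +oo[; rewrite set_itvNyy/= => ->; rewrite ltry.
exact: (integrable_lty measurableT (avg_integrable x cu bu)).
Qed.

(** Dominated convergence along a sequence tending to x: for fixed a the integrands converge because
    prepending a is continuous, and M f dominates them when M bounds |u|. *)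
Lemma avg_continuous u : continuous u -> is_bounded u ->
  continuous (avg f u).
Proof.
move=> cu bu; have [M uM] := bu; apply/rseq_continuous_seqP => x s xs.
have := @dominated_convergence _ _ _ lebesgue_measure setT measurableT
  (fun n a => (u (rseq_cons a (s n)) * f a)%:E)
  (fun a => (u (rseq_cons a x) * f a)%:E) (fun a => (M * f a)%:E).
case=> [n|||||].
- by apply/measurable_EFinP; exact: avg_measurable.
- by apply/measurable_EFinP; exact: avg_measurable.
- apply: aeW => a _; apply: cvg_EFin; first exact: nearW.
  apply: cvgMl; apply: (iffLR (rseq_continuous_seqP _) (@continuous_consr R u a cu)) xs.
- exact: (integrableZl measurableT M density_integrable).
- apply: aeW => a n _; rewrite lee_fin normrM (gtr0_norm (f_gt0 a)).
  by rewrite ler_wpM2r// ltW.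
move=> _ _ Hl; apply: fine_cvg; rewrite fineK//.
exact: (integrable_fin_num measurableT (avg_integrable x cu bu)).
Qed.

End average.

(** * Uniform positive lower bounds for superharmonic functions *)

Section lower_bound.
Context (R : realType) (f : R -> R).
Hypotheses (f_cont : continuous f) (f_gt0 : forall a, 0 < f a)
  (f_int1 : (\int[lebesgue_measure]_a (f a)%:E = 1)%E).

Lemma density_integrableS (E : set R) : measurable E ->
  lebesgue_measure.-integrable E (EFin \o f).
Proof.
by move=> mE; apply: integrableS (density_integrable f_cont f_gt0 f_int1).
Qed.

Lemma le_avg_subset (u : rseq R -> R) (x : rseq R) (E : set R) (c : R) :
  measurable E ->
  continuous u -> is_bounded u -> (forall y, 0 < u y) ->
  0 <= c -> (forall a, E a -> c <= u (rseq_cons a x)) ->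
  c * (\int[lebesgue_measure]_(a in E) f a) <= avg f u x.
Proof.
move=> mE cu bu u0 c0 cux.
rewrite /avg -RintegralZl//; last first.
  exact: density_integrableS.
rewrite -lee_fin /Rintegral !fineK; last 2 first.
- by apply: integrable_fin_num => //; exact: avg_integrable.
- apply: integrable_fin_num => //.
  exact: (integrableZl _ c (density_integrableS mE)).
have muf := avg_measurable f_cont x cu.
apply: (@le_trans _ _ (\int[lebesgue_measure]_(a in E) (u (rseq_cons a x) * f a)%:E)%E).
  apply: ge0_le_integral => //.
  - by move=> a _; rewrite lee_fin mulr_ge0// ltW.
  - apply/measurable_EFinP; apply: measurable_funM => //.
    apply: (measurable_funS measurableT) => //.
    exact: continuous_measurable_fun.
  - apply/measurable_EFinP; exact: (measurable_funS measurableT _ muf).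
  - by move=> a ra; rewrite lee_fin ler_wpM2r ?cux// ltW.
apply: ge0_subset_integral => //; first exact/measurable_EFinP.
by move=> a _; rewrite lee_fin mulr_ge0// ltW.
Qed.

(** The weights 1/(pi 2^n) are at most 2^-n, so the first k coordinates contribute at most B; the
    tail contributes at most 2^-k because distances are bounded by 1. *)
Lemma rseqd0_le (k : nat) (B : R) (x : rseq R) : 0 <= B ->
  (forall i, (i < k)%N -> `|atan (x i)| <= B) ->
  rseqd x (fun=> 0) <= B + 2^-1 ^+ k.
Proof.
move=> B0; elim: k x => [|k ih] x xB.
  by rewrite expr0 (le_trans (rseqd_le1 _ _))// lerDr.
rewrite rseqd_rec atan0 subr0 exprS.
have x0 : (pi * 2)^-1 * `|atan (x 0)| <= 2^-1 * B.
  apply: ler_pM => //; [by rewrite invr_ge0 mulr_ge0 ?pi_ge0| |exact: xB].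
  rewrite lef_pV2 ?posrE ?mulr_gt0 ?pi_gt0//; have := @pi_ge2 R; lra.
have := ih (rseq_shift x) (fun i ik => xB i.+1 ik).
rewrite /rseq_shift in x0 *; lra.
Qed.

(* Membership in a cylinder around 0 gives a bound by continuity at 0; each
   application of the averaging operator frees one coordinate. *)
Lemma positive_superharmonic_lower_bound (u : rseq R -> R) (kappa : R) :
  continuous u -> is_bounded u -> (forall y, 0 < u y) ->
  0 < kappa -> (forall x, kappa * avg f u x <= u x) ->
  exists2 c, 0 < c & forall x, c <= u x.
Proof.
move=> cu bu u0 k0 ku; pose o : rseq R := fun=> 0.
have /rseq_continuousP/(_ o (u o / 2)) := cu.
rewrite divr_gt0// => /(_ isT)[d d0 du].
(* The radius d of continuity at 0 is halved: one half bounds the arctangents of the first k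
   coordinates, the other absorbs the tail 2^-k. *)
have d20 : 0 < d / 2 by rewrite divr_gt0.
have [k kd] : exists k, 2^-1 ^+ k < d / 2.
  have : `|2^-1| < 1 :> R by rewrite ger0_norm ?invr_ge0// invf_lt1// ltr1n.
  move=> /cvg_expr/cvgrPdist_lt/(_ _ d20)[k _ /(_ k (leqnn k))]/=.
  by rewrite sub0r normrN ger0_norm ?exprn_ge0//; exists k.
have [r r0 rB] : exists2 r : R, 0 < r &
    forall a, `]-r, r[%classic a -> `|atan a| <= d / 2.
  have /cvgrPdist_lt/(_ _ d20)/nbhs_ballP[r /= r0 rB] := @continuous_atan R 0.
  exists r => // a; rewrite /= in_itv/= -ltr_norml -normrN -sub0r => /rB.
  by rewrite atan0 sub0r normrN => /ltW.
pose p := \int[lebesgue_measure]_(a in `]-r, r[%classic) f a.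
have p0 : 0 < p.
  apply: fine_gt0; apply/andP; split.
    apply: integral_pos_gt0 => //.
      by apply: (measurable_funS measurableT) => //; exact: continuous_measurable_fun.
    have := @lebesgue_measure_itv R `]-r, r[; rewrite /= lte_fin gtrN// => ->.
    by rewrite -EFinB lte_fin opprK addr_gt0.
  by apply: integrable_lty => //; exact: density_integrableS.
(* Here j counts the freed coordinates; at j = k no constraint is left and the bound is global. *)
suff H (j : nat) : (j <= k)%N -> exists2 c, 0 < c & forall x : rseq R,
    (forall i, (i < k - j)%N -> `|atan (x i)| <= d / 2) -> c <= u x.
  have [c c0 cu'] := H k (leqnn k).
  by exists c => // x; apply: cu' => i; rewrite subnn.
elim: j => [_|j ih jk].
  exists (u o / 2) => [|x]; first by rewrite divr_gt0.
  rewrite subn0 => /(rseqd0_le (ltW d20)) xB.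
  have : rseqd o x < d by rewrite rseqd_sym; apply: (le_lt_trans xB); lra.
  by move=> /du; rewrite ltr_norml; lra.
have [c c0 cH] := ih (ltnW jk).
(* Prepending a with |a| < r adds one controlled coordinate, so the previous bound c applies.
   Restricting the average to these a costs their mass p, and superharmonicity costs [kappa]. *)
exists (kappa * (c * p)) => [|x xB]; first by rewrite !mulr_gt0.
apply: (le_trans _ (ku x)); rewrite ler_pM2l//.
apply: (@le_avg_subset u x `]-r, r[%classic c) => // [|a ra]; first exact: ltW.
apply: cH => -[|i] /= ik; first exact: rB.
by apply: xB; move: ik; rewrite -subSS subSn.
Qed.

End lower_bound.

(** * Integrals of differences of logarithms *)

Section log_ratio_integral.
Context d (T : measurableType d) (R : realType).
Variable mu : {measure set T -> \bar R}.
Local Open Scope ereal_scope.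

(** The ratio (p + e)/(v + e) lies between p/v and 1, so the perturbation can only shrink the
    positive part of the logarithm. *)
Lemma ln_pert_le (p v e : R) : (0 < p -> 0 < v -> 0 < e ->
  Num.max (ln (p + e) - ln (v + e)) 0 <= Num.max (ln p - ln v) 0)%R.
Proof.
move=> p0 v0 e0; rewrite ge_max !le_max lexx !orbT andbT.
rewrite -!ln_div ?posrE ?addr_gt0//; have [pv|vp] := leP p v.
  by rewrite [X in _ || X]ln_le0 ?orbT// ler_pdivrMr ?addr_gt0// mul1r lerD2r.
rewrite ler_ln ?posrE ?divr_gt0 ?addr_gt0//.
rewrite ler_pdivrMr ?addr_gt0// mulrAC ler_pdivlMr// mulrDl mulrDr lerD2l.
by rewrite mulrC ler_pM2r// ltW.
Qed.

Lemma ln_pert_cvg (p v : R) : (0 < p -> 0 < v ->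
  ln (p + n.+1%:R^-1) - ln (v + n.+1%:R^-1) @[n --> \oo] --> ln p - ln v)%R.
Proof.
have H (x : R) : (0 < x -> ln (x + n.+1%:R^-1) @[n --> \oo] --> ln x)%R.
  move=> x0; apply: continuous_cvg; first exact: continuous_ln.
  rewrite -[X in _ --> X]addr0; apply: cvgD; first exact: cvg_cst.
  exact: cvg_harmonic.
by move=> p0 v0; apply: cvgB; exact: H.
Qed.

(* The perturbation by e makes the logarithms integrable; it shrinks
   ln p - ln v towards 0 without changing its sign, so Fatou's lemma applies. *)
Lemma integral_ln_neg_le_pos (p v : T -> R) :
  measurable_fun setT p -> measurable_fun setT v ->
  (forall x, (0 < p x)%R) -> (forall x, (0 < v x)%R) ->
  (forall e : R, (0 < e)%R ->
    mu.-integrable setT (fun x => (ln (p x + e) - ln (v x + e))%:E) /\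
    0 <= \int[mu]_x (ln (p x + e) - ln (v x + e))%:E) ->
  \int[mu]_x ((fun y => (ln (p y) - ln (v y))%:E)^\- x) <=
  \int[mu]_x ((fun y => (ln (p y) - ln (v y))%:E)^\+ x).
Proof.
move=> mp mv p0 v0 h; pose w x := (ln (p x) - ln (v x))%R.
rewrite (_ : (fun y => (ln (p y) - ln (v y))%:E) = EFin \o w)//.
pose g n x : R := (ln (p x + n.+1%:R^-1) - ln (v x + n.+1%:R^-1))%R.
have n0 n : (0 < n.+1%:R^-1 :> R)%R by rewrite invr_gt0 ltr0n.
have mln (u : T -> R) (c : R) : measurable_fun setT u ->
    measurable_fun setT (fun x => ln (u x + c)%R).
  move=> mu_; apply: (measurableT_comp (@measurable_ln R)).
  exact: measurable_funD.
have mg n : measurable_fun setT (g n) by apply: measurable_funB; exact: mln.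
have mw : measurable_fun setT w.
  by apply: measurable_funB; apply: (measurableT_comp (@measurable_ln R)).
have mEg n : measurable_fun setT (EFin \o g n) by exact/measurable_EFinP.
have mEw : measurable_fun setT (EFin \o w) by exact/measurable_EFinP.
(* The integral of [g n] is nonnegative, so its negative part integrates to at most its positive
   part, which [ln_pert_le] bounds by that of w, uniformly in n. *)
have gneg n : \int[mu]_x ((EFin \o g n)^\- x) <= \int[mu]_x ((EFin \o w)^\+ x).
  apply: (@le_trans _ _ (\int[mu]_x ((EFin \o g n)^\+ x))).
    have [ig] := h _ (n0 n); rewrite integralE suber_ge0//.
    by apply: integrable_fin_num => //; exact: integrable_funeneg.
  apply: ge0_le_integral => //.
  - exact: measurable_funepos.
  - exact: measurable_funepos.
  - by move=> x _; rewrite !funeposE /= -!EFin_max lee_fin ln_pert_le.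
have := @fatou _ _ _ mu setT measurableT (fun n => (EFin \o g n)^\-).
move=> /(_ (fun n => measurable_funeneg (mEg n)) (fun n x _ => funeneg_ge0 _ x)) F.
(* Two facts remain: the negative parts of [g n] converge pointwise to that of w, and the lower
   limit of their integrals inherits the bound [gneg]. *)
apply: (le_trans _ (le_trans F _)).
  rewrite le_eqVlt; apply/orP; left; apply/eqP; apply: eq_integral => x _.
  rewrite funenegE /= -EFin_max.
  have /cvg_limn_einf_sup[-> //] :
      (EFin \o g n)^\- x @[n --> \oo] --> (Num.max (- w x) 0)%R%:E.
  under eq_fun do rewrite funenegE /= -EFin_max.
  apply: cvg_EFin; first exact: nearW.
  (* Writing max(t, 0) as (t + |t|)/2 reduces the limit to sums and absolute values. *)
  rewrite maxr_absE subr0 addr0; under eq_fun do rewrite maxr_absE subr0 addr0.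
  have gw : (- g n x @[n --> \oo] --> - w x)%R by apply: cvgN; exact: ln_pert_cvg.
  by apply: cvgMl; apply: cvgD => //; exact: cvg_norm.
rewrite limn_einf_lim; apply: lime_le; first exact: is_cvg_einfs.
apply: nearW => n; apply: (le_trans _ (gneg n)); apply: ereal_inf_lbound.
by exists n => /=.
Qed.

(** Since w may fail to be integrable, the integral of L cannot be split at once; the assumption
    that it exists decides between two cases. *)
Lemma le_integral_add (g w L : T -> R) : (forall x, L x = g x + w x)%R ->
  mu.-integrable setT (EFin \o g) -> measurable_fun setT w ->
  \int[mu]_x ((EFin \o w)^\- x) <= \int[mu]_x ((EFin \o w)^\+ x) ->
  \int[mu]_x ((EFin \o L)^\+ x) < +oo \/ \int[mu]_x ((EFin \o L)^\- x) < +oo ->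
  \int[mu]_x (g x)%:E <= \int[mu]_x (L x)%:E.
Proof.
move=> LE ig mw nw hL.
have mEw : measurable_fun setT (EFin \o w) by exact/measurable_EFinP.
have /integrableP[mg igoo] := ig.
have mL : measurable_fun setT L.
  rewrite (_ : L = fun x => g x + w x)%R; last exact/funext.
  by apply: measurable_funD => //; exact/measurable_EFinP.
have mEL : measurable_fun setT (EFin \o L) by exact/measurable_EFinP.
(* If the positive part of L has infinite integral, the negative part has a finite one, so the
   integral of L is +oo and the bound is trivial. *)
have [Lp|Lp] := ltP (\int[mu]_x ((EFin \o L)^\+ x)) +oo; last first.
  move: hL Lp; rewrite leye_eq => -[Lp /eqP Loo|Ln /eqP Lp].
    by rewrite Loo in Lp.
  rewrite [leRHS](_ : _ = +oo) ?leey//.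
  rewrite -[LHS]/(\int[mu]_x ((EFin \o L) x)) integralE Lp addye//.
  by rewrite eqe_oppLR; apply: contraTN Ln => /eqP ->.
(* From w = L - g, the positive part of w is at most that of L plus |g|. Then [nw] makes w
   integrable, with nonnegative integral. *)
have wp : \int[mu]_x ((EFin \o w)^\+ x) < +oo.
  apply: (@le_lt_trans _ _ (\int[mu]_x ((EFin \o L)^\+ x + `|(g x)%:E|))).
    apply: ge0_le_integral => //.
    - exact: measurable_funepos.
    - by apply: emeasurable_funD; [exact: measurable_funepos|exact: measurableT_comp].
    - move=> x _; rewrite !funeposE /= -!EFin_max lee_fin.
      rewrite ge_max addr_ge0 ?le_max ?lexx ?orbT// andbT.
      apply: (@le_trans _ _ (L x + `|g x|)%R).
        by rewrite LE; have := ler_norm (- g x)%R; rewrite normrN; lra.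
      by rewrite lerD2r le_max lexx.
  rewrite ge0_integralD//; [|exact: measurable_funepos|exact: measurableT_comp].
  by rewrite lte_add_pinfty.
have iw : mu.-integrable setT (EFin \o w).
  apply/integrableP; split => //.
  rewrite (_ : (fun x => `|_|) = abse \o (EFin \o w))// fune_abse.
  rewrite ge0_integralD//; [|exact: measurable_funepos|exact: measurable_funeneg].
  by rewrite lte_add_pinfty// (le_lt_trans nw).
rewrite [leRHS](_ : _ = \int[mu]_x ((EFin \o g) x + (EFin \o w) x)); last first.
  by apply: eq_integral => x _; rewrite LE.
rewrite integralD// leeDl// integralE suber_ge0//.
by apply: integrable_fin_num => //; exact: integrable_funeneg.
Qed.

End log_ratio_integral.

(** * Operations on continuous and bounded functions *)

Lemma rseq_shift_cons (R : realType) (a : R) (x : rseq R) :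
  rseq_shift (rseq_cons a x) = x.
Proof. by []. Qed.

Lemma rseq_continuous_comp (R : realType) (u : rseq R -> R) (h : R -> R) :
  continuous u -> (forall x, {for u x, continuous h}) ->
  continuous (fun x => h (u x)).
Proof. by move=> cu ch x; exact: (continuous_comp (cu x) (ch x)). Qed.

Lemma rseq_continuousM (R : realType) (u v : rseq R -> R) :
  continuous u -> continuous v -> continuous (fun x => u x * v x).
Proof. by move=> cu cv x; exact: (continuousM (cu x) (cv x)). Qed.

Lemma rseq_continuousB (R : realType) (u v : rseq R -> R) :
  continuous u -> continuous v -> continuous (fun x => u x - v x).
Proof. by move=> cu cv x; exact: (continuousB (cu x) (cv x)). Qed.

Lemma rseq_continuousD (R : realType) (u v : rseq R -> R) :
  continuous u -> continuous v -> continuous (fun x => u x + v x).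
Proof. by move=> cu cv x; exact: (continuousD (cu x) (cv x)). Qed.

Lemma rseq_continuousV (R : realType) (u : rseq R -> R) :
  continuous u -> (forall x, u x != 0) -> continuous (fun x => (u x)^-1).
Proof. by move=> cu u0 x; exact: (continuousV (u0 x) (cu x)). Qed.

Lemma probability_integrable (R : realType) (mu : probability (rseq R) R)
    (u : rseq R -> R) : continuous u -> is_bounded u ->
  mu.-integrable setT (EFin \o u).
Proof.
move=> cu /bounded_funE bu; apply: measurable_bounded_integrable => //.
- by rewrite (le_lt_trans (probability_le1 _ _))// ltry.
- exact: continuous_measurable_rseq.
Qed.

Section bounded.
Context (T : Type) (R : realType).
Implicit Types u v : T -> R.

Lemma bounded_mul u v : is_bounded u ->
  is_bounded v -> exists M, forall x, `|u x * v x| <= M.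
Proof.
by move=> [M uM] [N vN]; exists (M * N) => x; rewrite normrM ler_pM.
Qed.

Lemma bounded_add u v : is_bounded u ->
  is_bounded v -> exists M, forall x, `|u x + v x| <= M.
Proof.
move=> [M uM] [N vN]; exists (M + N) => x.
by rewrite (le_trans (ler_normD _ _))// lerD.
Qed.

Lemma bounded_cst (c : R) : exists M, forall x : T, `|c| <= M.
Proof. by exists `|c|. Qed.

Lemma bounded_inv u c : 0 < c -> (forall x, c <= u x) ->
  exists M, forall x, `|(u x)^-1| <= M.
Proof.
move=> c0 cu; exists c^-1 => x; have u0 : 0 < u x by exact: (lt_le_trans c0).
by rewrite gtr0_norm ?invr_gt0// lef_pV2 ?posrE.
Qed.

Lemma bounded_ln u c : 0 < c -> (forall x, c <= u x) ->
  is_bounded u -> exists M, forall x, `|ln (u x)| <= M.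
Proof.
move=> c0 cu [M uM]; exists (`|ln c| + `|ln M|) => x.
have u0 : 0 < u x by exact: (lt_le_trans c0).
have uM' : u x <= M by rewrite (le_trans (ler_norm _)).
have cl : ln c <= ln (u x) by rewrite ler_ln ?posrE.
have lM : ln (u x) <= ln M by rewrite ler_ln ?posrE// (lt_le_trans u0).
have := ler_norm (ln M); have := ler_norm (- ln c); rewrite normrN => h1 h2.
have := normr_ge0 (ln M); have := normr_ge0 (ln c) => h3 h4.
by rewrite ler_norml; apply/andP; split; lra.
Qed.

End bounded.

(** Concavity: ln lies below its tangent at p. With p an average of v, averaging both sides yields
    Jensen's inequality. *)
Lemma ln_tangent (R : realType) (v p : R) : 0 < v -> 0 < p ->
  ln v <= ln p - 1 + p^-1 * v.
Proof.
move=> v0 p0; have vp : 0 < v / p by rewrite divr_gt0.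
have : ln (1 + (v / p - 1)) <= v / p - 1 by apply: le_ln1Dx; lra.
by rewrite addrC subrK ln_div ?posrE// (mulrC v); lra.
Qed.

(** * The eigenfunction and the upper bound for the entropy *)

Section transfer.
Context (R : realType) (alpha : R) (f : R -> R).
Hypotheses (alpha_gt0 : 0 < alpha)
  (f_cont : continuous f) (f_gt0 : forall a, 0 < f a)
  (f_int1 : (\int[lebesgue_measure]_a (f a)%:E = 1)%E).
Variables (A : rseq R -> R) (lambda : R) (psi : rseq R -> R).
Hypotheses (A_holder : holder alpha A)
  (eigen : main_eigenpair alpha f A lambda psi).

Let lambda_gt0 : 0 < lambda. Proof. by case: eigen. Qed.
Let psi_gt0 x : 0 < psi x. Proof. by case: eigen. Qed.
Let A_cont : continuous A. Proof. exact: holder_continuous A_holder. Qed.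
Let psi_cont : continuous psi.
Proof. by case: eigen => _ /(holder_continuous alpha_gt0). Qed.
Let A_bounded : is_bounded A.
Proof. exact: holder_bounded A_holder. Qed.
Let psi_bounded : is_bounded psi.
Proof. by case: eigen => _ /(holder_bounded alpha_gt0). Qed.

(** The test function of the upper bound: the eigenvalue equation reads L_0 G = lambda psi. It is
    also the weight that expresses L_{\bar A} through L_0. *)
Let G y := expR (A y) * psi y.

Let G_gt0 y : 0 < G y. Proof. by rewrite mulr_gt0 ?expR_gt0. Qed.

Let avgG x : avg f G x = lambda * psi x.
Proof. by case: eigen => _ _ _ <-. Qed.

Let G_cont : continuous G.
Proof.
apply: rseq_continuousM => //.
exact: (rseq_continuous_comp A_cont (fun x => @continuous_expR R (A x))).
Qed.

Let G_bounded : is_bounded G.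
Proof.
apply: bounded_mul => //; have [M AM] := A_bounded; exists (expR M) => y.
by rewrite gtr0_norm ?expR_gt0// ler_expR (le_trans (ler_norm _)).
Qed.

(** If |A| <= M, then lambda psi = L_A psi >= e^{-M} L_0 psi, so psi is superharmonic with constant
    e^{-M}/lambda. The space is not compact, so pointwise positivity alone gives no uniform
    bound. *)
Let psi_ge : exists2 c, 0 < c & forall x, c <= psi x.
Proof.
have [M AM] := A_bounded.
apply: (@positive_superharmonic_lower_bound _ _ f_cont f_gt0 f_int1 _
  (lambda^-1 * expR (- M))) => //.
  by rewrite mulr_gt0 ?invr_gt0 ?expR_gt0.
move=> x; rewrite -mulrA ler_pdivrMl// -avgG -avgZ//.
apply: avg_le => //.
- by apply: rseq_continuousM => //; exact: cst_continuous.
- by apply: bounded_mul => //; exact: bounded_cst.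
- move=> a; rewrite ler_pM2r// ler_expR.
  by have := AM (rseq_cons a x); rewrite ler_norml => /andP[].
Qed.

Let G_ge : exists2 c, 0 < c & forall x, c <= G x.
Proof.
have [M AM] := A_bounded; have [c c0 psic] := psi_ge.
exists (expR (- M) * c) => [|x]; first by rewrite mulr_gt0 ?expR_gt0.
apply: ler_pM => //; first exact: ltW.
by rewrite ler_expR; have := AM x; rewrite ler_norml => /andP[].
Qed.

(** At y = ax the value psi(sigma y) = psi(x) does not depend on a, so it leaves the integral
    together with lambda; the remaining kernel is [G]. *)
Lemma ruelle_normalizedE (phi : rseq R -> R) x :
  continuous phi -> is_bounded phi ->
  ruelle f (normalized A lambda psi) phi x =
  (lambda * psi x)^-1 * avg f (fun y => G y * phi y) x.
Proof.
move=> cphi bphi; rewrite -avgZ//; last 2 first.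
- exact: rseq_continuousM.
- exact: bounded_mul.
rewrite /ruelle /avg; apply: eq_Rintegral => a _; congr (_ * _).
rewrite mulrA; congr (_ * _).
rewrite /normalized rseq_shift_cons !expRB expRD !lnK ?posrE// /G.
by rewrite [RHS]mulrC invfM [RHS]mulrA [RHS]mulrAC.
Qed.

Lemma ruelle0E (u : rseq R -> R) x : ruelle f (fun=> 0) u x = avg f u x.
Proof.
by rewrite /ruelle; apply: eq_Rintegral => a _; rewrite expR0 mul1r.
Qed.

Lemma log_ratio_eigenfunction x : log_ratio f G x = ln lambda - A x.
Proof.
rewrite /log_ratio ruelle0E avgG /G invfM mulrACA mulfV ?lt0r_neq0// mulr1.
by rewrite ln_div ?posrE ?expR_gt0// expRK.
Qed.

Lemma integral_energy (mu : probability (rseq R) R) :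
  (\int[mu]_x (ln lambda - A x)%:E = (ln lambda)%:E - \int[mu]_x (A x)%:E)%E.
Proof.
under eq_integral do rewrite EFinB.
rewrite integralB_EFin//; last exact: probability_integrable.
  by rewrite integral_cst//= probability_setT mule1.
by apply: probability_integrable; [exact: cst_continuous|exists `|ln lambda|].
Qed.

Lemma entropy_le (mu : probability (rseq R) R) :
  (entropy f mu <= (ln lambda)%:E - \int[mu]_x (A x)%:E)%E.
Proof.
rewrite -integral_energy; apply: ereal_inf_lbound; exists G; last first.
  by apply: eq_integral => x _; rewrite log_ratio_eigenfunction.
split; first by split => //; exact/bounded_funE.
(* The log-ratio of [G] is bounded and continuous, hence integrable for every probability
   measure. *)
left; rewrite (_ : _ \o _ = EFin \o (fun x => ln lambda - A x)); last first.
  by apply/funext => x /=; rewrite log_ratio_eigenfunction.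
apply: integrable_lty => //; apply: integrable_funepos => //.
apply: probability_integrable.
  by apply: rseq_continuousB => //; exact: cst_continuous.
have [M AM] := A_bounded; exists (`|ln lambda| + M) => y.
by rewrite (le_trans (ler_normB _ _))// lerD2l.
Qed.

(** * The lower bound for the entropy of the Gibbs state *)

Section gibbs.
Variable mu : probability (rseq R) R.
Hypothesis mu_dual : ruelle_dual f (normalized A lambda psi) mu mu.

(** Put v = u/G. Since L_{\bar A} fixes constants and sends v to L_0 u/(lambda psi), the first
    logarithm is that of L_{\bar A}(v + e). Jensen's inequality and the duality then give the
    sign. *)
Lemma integral_ln_transfer (u : rseq R -> R) (e : R) :
  continuous u -> is_bounded u -> (forall y, 0 < u y) ->
  0 < e ->
  mu.-integrable setT (fun x => (ln (avg f u x / (lambda * psi x) + e)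
                                 - ln (u x / G x + e))%:E) /\
  (0 <= \int[mu]_x (ln (avg f u x / (lambda * psi x) + e)
                    - ln (u x / G x + e))%:E)%E.
Proof.
move=> cu bu u0 e0; pose P x := avg f u x / (lambda * psi x) + e.
pose V x := u x / G x + e.
have lpsi0 x : 0 < lambda * psi x by rewrite mulr_gt0.
have eP x : e <= P x by rewrite lerDr divr_ge0// ltW// avg_gt0.
have eV x : e <= V x by rewrite lerDr divr_ge0// ltW.
have P0 x : 0 < P x by exact: (lt_le_trans e0).
have V0 x : 0 < V x by exact: (lt_le_trans e0).
have clpsiV : continuous (fun x => (lambda * psi x)^-1).
  apply: rseq_continuousV => [|x]; last by rewrite lt0r_neq0.
  by apply: rseq_continuousM => //; exact: cst_continuous.
have blpsiV : exists M, forall x, `|(lambda * psi x)^-1| <= M.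
  have [c c0 psic] := psi_ge; apply: (@bounded_inv _ _ _ (lambda * c)).
    by rewrite mulr_gt0.
  by move=> x; rewrite ler_pM2l.
have cP : continuous P.
  apply: rseq_continuousD; last exact: cst_continuous.
  by apply: rseq_continuousM => //; exact: avg_continuous.
have bP : is_bounded P.
  apply: bounded_add; last exact: bounded_cst.
  by apply: bounded_mul => //; exact: avg_bounded.
have cV : continuous V.
  apply: rseq_continuousD; last exact: cst_continuous.
  apply: rseq_continuousM => //; apply: rseq_continuousV => // y.
  by rewrite lt0r_neq0.
(* Boundedness of u/G relies on the uniform lower bound for [G], hence on that for psi. *)
have bV : is_bounded V.
  apply: bounded_add; last exact: bounded_cst.
  apply: bounded_mul => //; have [c c0 Gc] := G_ge; exact: bounded_inv c0 Gc.
have clnP : continuous (fun x => ln (P x)).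
  by apply: rseq_continuous_comp => // x; exact: continuous_ln.
have clnV : continuous (fun x => ln (V x)).
  by apply: rseq_continuous_comp => // x; exact: continuous_ln.
have blnP := bounded_ln e0 eP bP.
have blnV := bounded_ln e0 eV bV.
have ilnP := probability_integrable mu clnP blnP.
have ilnV := probability_integrable mu clnV blnV.
have ceG : continuous (fun y => e * G y).
  by apply: rseq_continuousM => //; exact: cst_continuous.
have beG : exists M, forall y, `|e * G y| <= M.
  by apply: bounded_mul => //; exact: bounded_cst.
have cW : continuous (fun y => u y + e * G y) by exact: rseq_continuousD.
have bW : exists M, forall y, `|u y + e * G y| <= M by exact: bounded_add.
(* Jensen's inequality at a fixed x: [ln (V y)] is replaced by the tangent of ln at [P x], which is
   then averaged with weight [G]. *)
have key x : ruelle f (normalized A lambda psi) (fun y => ln (V y)) x <= ln (P x).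
  rewrite ruelle_normalizedE// mulrC ler_pdivrMr//.
  have cl : continuous (fun y => (ln (P x) - 1) * G y).
    by apply: rseq_continuousM => //; exact: cst_continuous.
  have bl : exists M, forall y, `|(ln (P x) - 1) * G y| <= M.
    by apply: bounded_mul => //; exact: bounded_cst.
  have cr : continuous (fun y => (P x)^-1 * (u y + e * G y)).
    by apply: rseq_continuousM => //; exact: cst_continuous.
  have br : exists M, forall y, `|(P x)^-1 * (u y + e * G y)| <= M.
    by apply: bounded_mul => //; exact: bounded_cst.
  apply: (@le_trans _ _ (avg f (fun y => (ln (P x) - 1) * G y
                                 + (P x)^-1 * (u y + e * G y)) x)).
    apply: avg_le => //.
    - exact: rseq_continuousM.
    - exact: rseq_continuousD.
    - exact: bounded_mul.
    - exact: bounded_add.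
    - move=> a; set y := rseq_cons a x.
      have -> : u y + e * G y = G y * V y.
        by rewrite mulrDr (mulrC (G y) (_ / _)) divfK ?lt0r_neq0// (mulrC e).
      rewrite (mulrC _ (G y)) mulrCA -mulrDr ler_pM2l//; exact: ln_tangent.
  (* The slope term averages to exactly lambda psi(x), cancelling the contribution of the constant
     -1. *)
  rewrite avgD// !avgZ// avgD// avgZ// avgG.
  have -> : avg f u x + e * (lambda * psi x) = P x * (lambda * psi x).
    by rewrite mulrDl divfK// lt0r_neq0.
  by rewrite mulKf ?lt0r_neq0// mulrBl mul1r subrK.
split.
  by have := integrableB measurableT ilnP ilnV.
rewrite [leRHS](_ : _ = \int[mu]_x (ln (P x))%:E - \int[mu]_x (ln (V x))%:E)%E; last first.
  by rewrite -integralB_EFin.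
rewrite suber_ge0; last exact: integrable_fin_num.
(* Duality trades the integral of ln V for that of L_{\bar A}(ln V), which [key] compares pointwise
   with ln P. *)
rewrite [leLHS](mu_dual clnV); last exact/bounded_funE.
apply: le_integral => //; last by move=> x _; rewrite lee_fin.
apply: (@probability_integrable _ mu (ruelle f (normalized A lambda psi) _)).
- rewrite (_ : ruelle _ _ _ = fun x => (lambda * psi x)^-1 *
      avg f (fun y => G y * ln (V y)) x); last first.
    by apply/funext => x; rewrite ruelle_normalizedE.
  apply: rseq_continuousM => //; apply: avg_continuous => //.
    exact: rseq_continuousM.
  exact: bounded_mul.
- rewrite (_ : ruelle _ _ _ = fun x => (lambda * psi x)^-1 *
      avg f (fun y => G y * ln (V y)) x); last first.
    by apply/funext => x; rewrite ruelle_normalizedE.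
  apply: bounded_mul => //; apply: avg_bounded => //.
    exact: rseq_continuousM.
  exact: bounded_mul.
Qed.

Lemma entropy_ge : ((ln lambda)%:E - \int[mu]_x (A x)%:E <= entropy f mu)%E.
Proof.
rewrite -integral_energy; apply: le_ereal_inf_tmp => _ [u [[cu /bounded_funE bu u0] hu]] <-.
have avg_u0 x : 0 < avg f u x by exact: avg_gt0.
pose p x := avg f u x / (lambda * psi x); pose v x := u x / G x.
have p0 x : 0 < p x by rewrite divr_gt0// mulr_gt0.
have v0 x : 0 < v x by rewrite divr_gt0.
have mp : measurable_fun setT p.
  apply: continuous_measurable_rseq; apply: rseq_continuousM.
    exact: avg_continuous.
  apply: rseq_continuousV => [|y]; last by rewrite lt0r_neq0// mulr_gt0.
  by apply: rseq_continuousM => //; exact: cst_continuous.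
have mv : measurable_fun setT v.
  apply: continuous_measurable_rseq; apply: rseq_continuousM => //.
  by apply: rseq_continuousV => // y; rewrite lt0r_neq0.
(* The log-ratio splits into the bounded term ln lambda - A and ln p - ln v, which need not be
   integrable. *)
apply: (@le_integral_add _ _ _ mu _ (fun x => ln (p x) - ln (v x))) => //.
- move=> x; rewrite /log_ratio ruelle0E /p /v.
  rewrite ln_div ?posrE// !ln_div ?posrE ?mulr_gt0 ?expR_gt0//.
  by rewrite !lnM ?posrE ?expR_gt0// expRK; ring.
- apply: probability_integrable.
    by apply: rseq_continuousB => //; exact: cst_continuous.
  have [M AM] := A_bounded; exists (`|ln lambda| + M) => y.
  by rewrite (le_trans (ler_normB _ _))// lerD2l.
- by apply: measurable_funB; apply: (measurableT_comp (@measurable_ln R)).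
- apply: integral_ln_neg_le_pos => // e e0; exact: integral_ln_transfer.
Qed.

End gibbs.
End transfer.

(** * The variational principle and its attainment at the Gibbs state *)

Unset Implicit Arguments.
Set Strict Implicit.

Theorem theorem2p8 (R : realType) (alpha : R) (f : R -> R)
    (alpha_gt0 : 0 < alpha) (alpha_le1 : alpha <= 1)
    (f_cont : continuous f) (f_gt0 : forall a, 0 < f a)
    (f_int1 : (\int[lebesgue_measure]_a (f a)%:E = 1)%E)
    (A : rseq R -> R) (A_holder : holder alpha A)
    (lambda : R) (psi : rseq R -> R)
    (eigen : main_eigenpair alpha f A lambda psi)
    (muA : probability (rseq R) R)
    (gibbs : gibbs_state f A lambda psi muA) :
  (ln lambda)%:E = ereal_sup
    [set (entropy f mu + \int[mu]_x (A x)%:E)%E | mu in @shift_invariant R]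
  /\
  (entropy f muA + \int[muA]_x (A x)%:E)%E = ereal_sup
    [set (entropy f mu + \int[mu]_x (A x)%:E)%E | mu in @shift_invariant R].
Proof.
have [muA_inv muA_dual] := gibbs.
(* Finite energy permits cancellation in the extended reals. *)
have Afin (mu : probability (rseq R) R) : (\int[mu]_x (A x)%:E)%E \is a fin_num.
  apply: integrable_fin_num => //; apply: probability_integrable.
    exact: holder_continuous A_holder.
  exact: holder_bounded A_holder.
have muAE : (entropy f muA + \int[muA]_x (A x)%:E)%E = (ln lambda)%:E.
  rewrite [X in (X + _)%E](_ : _ = (ln lambda)%:E - \int[muA]_x (A x)%:E)%E.
    by rewrite subeK.
  by apply/eqP; rewrite eq_le (entropy_le alpha_gt0 A_holder eigen)//
    (entropy_ge alpha_gt0 f_cont f_gt0 f_int1 A_holder eigen muA_dual).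
rewrite muAE; suff : ereal_sup [set (entropy f mu + \int[mu]_x (A x)%:E)%E
    | mu in @shift_invariant R] = (ln lambda)%:E by [].
(* The entropy bound for every measure gives one inequality; the invariant measure [muA], whose
   value is ln lambda, gives the other. *)
apply/eqP; rewrite eq_le; apply/andP; split.
  apply: ge_ereal_sup => _ [mu _ <-]; rewrite -leeBrDr//.
  exact: (entropy_le alpha_gt0 A_holder eigen).
by apply: ereal_sup_ubound; exists muA.
Qed.
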